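(* Let $\mathbb{F}$ be a field and let $(P,\cdot,[-,-])$ be a Poisson algebra over $\mathbb{F}$. Let $(\sigma,s)$ be a homothetic datum on the associative algebra $(P,\cdot)$, let $t\in P$, and let $\lambda,\mu\colon P\to P$ be linear endomorphisms such that $$\lambda([a,b])=[\lambda(a),b]-[a,\mu(b)]\qquad\text{for all } a,b\in P. \quad (\ast)$$ Then the associative affgebra $\mathfrak{p}(\sigma,s)$, i.e. $P$ viewed as an affine space with the product $a\bullet b=ab+a\sigma+\sigma b+s$, is a Poisson affgebra with the affine Poisson bracket $$\{a,b\}=[a,b]+\mu(a)+\lambda(b)+t$$ if and only if $\lambda$ and $\mu$ are derivations on $(P,\cdot)$. Denote the resulting Poisson affgebra by $\mathfrak{p}(P;\sigma,s;\mu,\lambda,t)$. Furthermore, for all $o\in P$, $T_o\,\mathfrak{p}(P;\sigma,s;\mu,\lambda,t)\cong P$ as Poisson algebras. Conversely, given any Poisson affgebra $(\mathfrak{a},\bullet,\{-,-\})$ and a point $o\in\mathfrak{a}$, there exist linear endomorphisms $\mu,\lambda\colon T_o\mathfrak{a}\to T_o\mathfrak{a}$ (which are necessarily derivations on $(T_o\mathfrak{a},\cdot_o)$ satisfying $(\ast)$ with respect to the Lie bracket of $T_o\mathfrak{a}$) and a point $t\in\mathfrak{a}$ such that $\mathfrak{a}=\mathfrak{p}(T_o\mathfrak{a};\sigma_o,s_o;\mu,\lambda,t)$, where $(\sigma_o,s_o)$ is the homothetic datum on $(T_o\mathfrak{a},\cdot_o)$ given by $a\sigma_o=a\bullet o-o\bullet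 o$, $\sigma_o a=o\bullet a-o\bullet o$, $s_o=o\bullet o$ (operations $+,-$ in $T_o\mathfrak{a}$).
   Context: **Poisson algebra.** A vector space $P$ over $\mathbb{F}$ with a Lie bracket $[-,-]$ and an associative bilinear product $\cdot$ (written by juxtaposition; not assumed commutative or unital) with $[xy,z]=x[y,z]+[x,z]y$ for all $x,y,z$. **Affine spaces.** An abelian heap is a set with a ternary operation $\langle -,-,-\rangle$ satisfying $\langle\langle a,b,c\rangle,d,e\rangle=\langle a,b,\langle c,d,e\rangle\rangle$, $\langle a,b,b\rangle=a=\langle b,b,a\rangle$ and $\langle a,b,c\rangle=\langle c,b,a\rangle$; one writes $\langle a,b,c,d,e\rangle=\langle\langle a,b,c\rangle,d,e\rangle$, etc. An ($\mathbb{F}$-)affine space is a non-empty abelian heap $\mathfrak{a}$ with a map $\mathbb{F}\times\mathfrak{a}\times\mathfrak{a}\to\mathfrak{a}$, $(\alpha,a,b)\mapsto\alpha\triangleright_a b$, such that $\alpha\triangleright_a-$ is a heap morphism, $-\triangleright_a b$ is a heap morphism (with $\langle\alpha,\beta,\gamma\rangle=\alpha-\beta+\gamma$ on $\mathbb{F}$), $1\triangleright_a b=b$, $\alpha\triangleright_a(\beta\triangleright_a b)=(\alpha\beta)\triangleright_a b$, $0\triangleright_a b=a$, and $\alpha\triangleright_a b=\langle\alpha\triangleright_c b,\alpha\triangleright_c a,a\rangle$. An affine map is a heap morphism $f$ with $f(\alpha\triangleright_a b)=\alpha\triangleright_{f(a)}f(b)$; a bi-affine map is affine in each argument. For $o\in\mathfrak{a}$,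 the tangent space (fibre) $T_o\mathfrak{a}$ is the set $\mathfrak{a}$ with the vector space structure $a+b=\langle a,o,b\rangle$, $\alpha a=\alpha\triangleright_o a$, zero element $o$; then $\langle a,b,c\rangle=a-b+c$. A vector space $P$ is an affine space by $\langle a,b,c\rangle=a-b+c$, $\alpha\triangleright_a b=(1-\alpha)a+\alpha b$. **Associative affgebra.** An affine space $\mathfrak{a}$ with an associative bi-affine product $\bullet$. For $o\in\mathfrak{a}$, $T_o\mathfrak{a}$ is an associative algebra with product $a\cdot_o b=a\bullet b-a\bullet o+o\bullet o-o\bullet b$. **Lie affgebra.** An affine space $\mathfrak{a}$ with a bi-affine bracket $\{-,-\}$ such that $\langle\{a,b\},\{a,a\},\{b,a\}\rangle=\{b,b\}$ and $\langle\{a,\{b,c\}\},\{a,\{a,a\}\},\{b,\{c,a\}\},\{b,\{b,b\}\},\{c,\{a,b\}\}\rangle=\{c,\{c,c\}\}$ for all $a,b,c$. For $o\in\mathfrak{a}$, $T_o\mathfrak{a}$ is a Lie algebra with bracket $[a,b]=\{a,b\}-\{a,o\}+\{o,o\}-\{o,b\}$. **Deriffation.** For an affine map $D\colon\mathfrak{a}\to\mathfrak{a}$ on an associative affgebra, put $\Delta^D(a,b)=\langle D(a)\bullet b,D(a\bullet b),a\bullet D(b)\rangle$. $D$ is a deriffation if for all $o\in\mathfrak{a}$ and all $a,b$, $\Delta^D(a,b)-\Delta^D(a,o)+\Delta^D(o,o)-\Delta^D(o,b)=o$ in $T_o\mathfrak{a}$. **Poisson affgebra.** An associative affgebra with an affine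 Lie bracket $\{-,-\}$ (called the affine Poisson bracket) such that $\{-,z\}$ and $\{z,-\}$ are deriffations for all $z\in\mathfrak{a}$. The Poisson algebra structure on its fibre $T_o\mathfrak{a}$ consists of $\cdot_o$ and the bracket $[-,-]$ above. **Homothetic datum.** A double operator $\sigma=(\overleftarrow{\sigma},\overrightarrow{\sigma})$ on an associative algebra $A$ is a pair of linear endomorphisms, written $a\sigma=\overleftarrow{\sigma}(a)$, $\sigma a=\overrightarrow{\sigma}(a)$. It is a double homothetism if $\sigma(ab)=(\sigma a)b$, $(ab)\sigma=a(b\sigma)$, $a(\sigma b)=(a\sigma)b$ and $\sigma(a\sigma)=(\sigma a)\sigma$ for all $a,b\in A$. A homothetic datum is a pair $(\sigma,s)$ with $\sigma$ a double homothetism and $s\in A$ such that $\sigma s=s\sigma$ and $\sigma^2=\sigma+\bar s$, i.e. $(a\sigma)\sigma=a\sigma+as$ and $\sigma(\sigma a)=\sigma a+sa$ for all $a\in A$. For such a datum, $A$ (as an affine space) with $a\bullet b=ab+a\sigma+\sigma b+s$ is an associative affgebra. *)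

(* Defs.v *)
From HB Require Import structures.
From mathcomp Require Import all_boot all_order all_algebra.

Set Implicit Arguments.
Unset Strict Implicit.
Unset Printing Implicit Defensive.

Import GRing.Theory.
Local Open Scope ring_scope.

Section Algebras.
Variables (F : fieldType) (P : lmodType F).
Implicit Types (mul br : P -> P -> P).

Definition bilinear (op : P -> P -> P) : Prop :=
  (forall a, linear (op a)) /\ (forall b, linear (op^~ b)).

(* Commutativity and a unit are not assumed. *)
Definition assoc_algebra mul : Prop := bilinear mul /\ associative mul.

Definition lie_algebra br : Prop :=
  [/\ bilinear br, forall a, br a a = 0 &
      forall a b c, br a (br b c) + br b (br c a) + br c (br a b) = 0].

Definition poisson_algebra mul br : Prop :=
  [/\ assoc_algebra mul, lie_algebra br &
      forall x y z, br (mul x y) z = mul x (br y z) + mul (br x z) y].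

Definition derivation mul (d : P -> P) : Prop :=
  linear d /\ forall a b, d (mul a b) = mul (d a) b + mul a (d b).

(* The two components of a double operator sigma, as bare functions:
   [dop_l sigma a] is the element written "sigma a", and [dop_r sigma a] the
   one written "a sigma". Linearity is part of [double_homothetism]. *)
Record double_operator := DoubleOperator { dop_r : P -> P; dop_l : P -> P }.

Definition double_homothetism mul (sigma : double_operator) : Prop :=
  let R := dop_r sigma in let L := dop_l sigma in
  [/\ linear R, linear L &
   [/\ forall a b, L (mul a b) = mul (L a) b,
       forall a b, R (mul a b) = mul a (R b),
       forall a b, mul a (L b) = mul (R a) b &
       forall a, L (R a) = R (L a)]].

Definition homothetic_datum mul (sigma : double_operator) (s : P) : Prop :=
  let R := dop_r sigma in let L := dop_l sigma in
  [/\ double_homothetism mul sigma,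
      L s = R s,
      forall a, R (R a) = R a + mul a s &
      forall a, L (L a) = L a + mul s a].

Definition homothetic_product mul (sigma : double_operator) (s : P) : P -> P -> P :=
  fun a b => mul a b + dop_r sigma a + dop_l sigma b + s.

Definition affine_bracket br (mu lam : P -> P) (t : P) : P -> P -> P :=
  fun a b => br a b + mu a + lam b + t.

Definition bracket_compatible br (mu lam : P -> P) : Prop :=
  forall a b, lam (br a b) = br (lam a) b - br a (mu b).

End Algebras.

Definition poisson_isomorphic (F : fieldType) (P Q : lmodType F)
    (mulP brP : P -> P -> P) (mulQ brQ : Q -> Q -> Q) : Prop :=
  exists f : {linear P -> Q},
    [/\ bijective f,
        forall a b, f (mulP a b) = mulQ (f a) (f b) &
        forall a b, f (brP a b) = brQ (f a) (f b)].

HB.mixin Record isAbelianHeap T := {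
  heap : T -> T -> T -> T;
  heapA : forall a b c d e, heap (heap a b c) d e = heap a b (heap c d e);
  heapKr : forall a b, heap a b b = a;
  heapKl : forall a b, heap b b a = a;
  heapC : forall a b c, heap a b c = heap c b a
}.

#[short(type="abHeapType")]
HB.structure Definition AbelianHeap := { T of Choice T & isAbelianHeap T }.

Definition heap5 (T : abHeapType) (a b c d e : T) : T := heap (heap a b c) d e.

(* [act alpha a b] is alpha |>_a b. *)
HB.mixin Record isAffine (F : fieldType) T of AbelianHeap T := {
  affine_inhabited : inhabited T;
  act : F -> T -> T -> T;
  act_heap : forall (alpha : F) (a b c d : T),
    act alpha a (heap b c d) = heap (act alpha a b) (act alpha a c) (act alpha a d);
  act_scalar : forall alpha beta gamma a b,
    act (alpha - beta + gamma) a b = heap (act alpha a b) (act beta a b) (act gamma a b);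
  act1 : forall a b, act 1 a b = b;
  actA : forall alpha beta a b, act alpha a (act beta a b) = act (alpha * beta) a b;
  act0 : forall a b, act 0 a b = a;
  act_base : forall alpha a b c,
    act alpha a b = heap (act alpha c b) (act alpha c a) a
}.

#[short(type="affType")]
HB.structure Definition Affine (F : fieldType) :=
  { T of AbelianHeap T & isAffine F T }.

Definition affine_map (F : fieldType) (A B : affType F) (f : A -> B) : Prop :=
  (forall a b c, f (heap a b c) = heap (f a) (f b) (f c)) /\
  (forall (alpha : F) a b, f (act alpha a b) = act alpha (f a) (f b)).

Definition biaffine (F : fieldType) (A : affType F) (op : A -> A -> A) : Prop :=
  (forall a, affine_map (op a)) /\ (forall b, affine_map (op^~ b)).

(* The tangent space T_o A: an alias of A carrying the vector space structure
   with zero o. *)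
Definition tangent (F : fieldType) (A : affType F) (o : A) : Type := A.

Section Tangent.
Variables (F : fieldType) (A : affType F) (o : A).
Local Notation T := (tangent o).

Definition tangent_add (a b : T) : T := heap (a : A) o b.
Definition tangent_opp (a : T) : T := heap o (a : A) o.
Definition tangent_scale (alpha : F) (a : T) : T := act alpha o (a : A).

Fact tangent_addA : associative tangent_add.
Proof. by move=> a b c; rewrite /tangent_add heapA. Qed.

Fact tangent_addC : commutative tangent_add.
Proof. by move=> a b; rewrite /tangent_add heapC. Qed.

Fact tangent_add0 : left_id (o : T) tangent_add.
Proof. by move=> a; rewrite /tangent_add heapKl. Qed.

Fact tangent_addN : left_inverse (o : T) tangent_opp tangent_add.
Proof. by move=> a; rewrite /tangent_add /tangent_opp heapA heapKl heapKr. Qed.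

HB.instance Definition _ := Choice.on T.
HB.instance Definition _ :=
  GRing.isZmodule.Build T tangent_addA tangent_addC tangent_add0 tangent_addN.

Fact tangent_scaleA (a b : F) (v : T) :
  tangent_scale a (tangent_scale b v) = tangent_scale (a * b) v.
Proof. exact: actA. Qed.

Fact tangent_scale1 : left_id 1 tangent_scale.
Proof. by move=> v; exact: act1. Qed.

Fact act_id (alpha : F) (a : A) : act alpha a a = a.
Proof. by rewrite -[X in act _ _ X](act0 (F:=F) a a) actA mulr0 act0. Qed.

Fact tangent_scaleDr : right_distributive tangent_scale +%R.
Proof.
by move=> a u v; rewrite /GRing.add /= /tangent_add /tangent_scale act_heap act_id.
Qed.

Fact tangent_scaleDl (v : T) :
  {morph (tangent_scale^~ v) : a b / a + b}.
Proof.
move=> a b; rewrite {2}/GRing.add /= /tangent_add /tangent_scale.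
by rewrite -[in LHS](subr0 a) act_scalar act0.
Qed.

HB.instance Definition _ := GRing.Zmodule_isLmodule.Build F T
  tangent_scaleA tangent_scale1 tangent_scaleDr tangent_scaleDl.

End Tangent.

(* An alias, since an abstract lmodType cannot itself receive the instance. *)
Definition affine_of (F : fieldType) (P : lmodType F) : Type := P.

Section AffineOf.
Variables (F : fieldType) (P : lmodType F).
Local Notation T := (affine_of P).

Definition vheap (a b c : P) : P := a - b + c.
Definition vact (alpha : F) (a b : P) : P := (1 - alpha) *: a + alpha *: b.

Fact vheapA (a b c d e : P) :
  vheap (vheap a b c) d e = vheap a b (vheap c d e).
Proof. by rewrite /vheap !addrA. Qed.

Fact vheapKr (a b : P) : vheap a b b = a.
Proof. by rewrite /vheap subrK. Qed.

Fact vheapKl (a b : P) : vheap b b a = a.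
Proof. by rewrite /vheap subrr add0r. Qed.

Fact vheapC (a b c : P) : vheap a b c = vheap c b a.
Proof. by rewrite /vheap addrAC [a + c]addrC addrAC. Qed.

HB.instance Definition _ := Choice.on T.
HB.instance Definition _ :=
  isAbelianHeap.Build T vheapA vheapKr vheapKl vheapC.

Fact vactE (alpha : F) (a b : P) : vact alpha a b = a + alpha *: (b - a).
Proof. by rewrite /vact scalerBl scale1r scalerBr addrA addrAC. Qed.

Fact vact_heap (alpha : F) (a b c d : P) :
  vact alpha a (vheap b c d)
  = vheap (vact alpha a b) (vact alpha a c) (vact alpha a d).
Proof.
rewrite !vactE.
have -> : vheap b c d - a = (b - a) - (c - a) + (d - a).
  by rewrite /vheap opprB !addrA subrK.
move: (b - a) (c - a) (d - a) => x y z.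
rewrite /vheap !scalerDr scalerN opprD -!addrA.
by congr (_ + _); congr (_ + _); rewrite [RHS]addrCA addKr.
Qed.

Fact vact_scalar (alpha beta gamma : F) (a b : P) :
  vact (alpha - beta + gamma) a b
  = vheap (vact alpha a b) (vact beta a b) (vact gamma a b).
Proof.
rewrite !vactE /vheap !scalerDl scaleNr !opprD.
move: (_ *: _) (_ *: _) (_ *: _) => x y z.
by rewrite -!addrA; congr (_ + _); congr (_ + _); rewrite [RHS]addrCA addKr.
Qed.

Fact vact1 (a b : P) : vact 1 a b = b.
Proof. by rewrite /vact subrr scale0r add0r scale1r. Qed.

Fact vactA (alpha beta : F) (a b : P) :
  vact alpha a (vact beta a b) = vact (alpha * beta) a b.
Proof. by rewrite !vactE [a + _ - a]addrAC subrr add0r scalerA. Qed.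

Fact vact0 (a b : P) : vact 0 a b = a.
Proof. by rewrite /vact subr0 scale1r scale0r addr0. Qed.

Fact vact_base (alpha : F) (a b c : P) :
  vact alpha a b = vheap (vact alpha c b) (vact alpha c a) a.
Proof.
rewrite !vactE /vheap opprD addrACA subrr add0r -scalerBr.
have -> : b - c - (a - c) = b - a by rewrite opprB addrA subrK.
by rewrite addrC.
Qed.

Fact affine_of_inhabited : inhabited T.
Proof. exact (inhabits (0 : P)). Qed.

HB.instance Definition _ := isAffine.Build F T affine_of_inhabited
  vact_heap vact_scalar vact1 vactA vact0 vact_base.

End AffineOf.

Section Affgebras.
Variables (F : fieldType) (A : affType F).
Implicit Types (bul cur op : A -> A -> A) (o : A).

Definition assoc_affgebra bul : Prop := biaffine bul /\ associative bul.

Definition lie_affgebra cur : Prop :=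
  [/\ biaffine cur,
      forall a b, heap (cur a b) (cur a a) (cur b a) = cur b b &
      forall a b c,
        heap5 (cur a (cur b c)) (cur a (cur a a)) (cur b (cur c a))
              (cur b (cur b b)) (cur c (cur a b))
        = cur c (cur c c)].

(* Both the product and the bracket of the fibre at o are of this form. *)
Definition fibre_op op o : tangent o -> tangent o -> tangent o := fun a b =>
  let m : tangent o -> tangent o -> tangent o := op in
  m a b - m a o + m o o - m o b.
Arguments fibre_op op o a b : clear implicits.

Definition defect bul (D : A -> A) (a b : A) : A :=
  heap (bul (D a) b) (D (bul a b)) (bul a (D b)).

Definition deriffation bul (D : A -> A) : Prop :=
  affine_map D /\
  forall o (a b : tangent o), fibre_op (defect bul D) o a b = 0.

Definition poisson_affgebra bul cur : Prop :=
  [/\ assoc_affgebra bul, lie_affgebra cur &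
      forall z, deriffation bul (cur^~ z) /\ deriffation bul (cur z)].

Definition sigma_at bul o : double_operator (tangent o) :=
  let m : tangent o -> tangent o -> tangent o := bul in
  DoubleOperator (fun a => m a o - m o o) (fun a => m o a - m o o).

Definition s_at bul o : tangent o := bul o o.

(* Equality of (A, bul, cur) with p(T_o A; sigma_o, s_o; mu, lam, t): both have
   the same carrier, so it says that the heap operations, the scalar actions,
   the products and the brackets coincide. [@heap p] and [@act F p] are those
   of the affine space built from the vector space T_o A. *)
Definition equals_standard bul cur o (mu lam : tangent o -> tangent o)
    (t : tangent o) : Prop :=
  let p : affType F := affine_of (tangent o) in
  [/\ forall a b c : A, heap a b c = @heap p a b c,
      forall (alpha : F) (a b : A), act alpha a b = @act F p alpha a b,
      forall a b : A,
        bul a b = homothetic_product (fibre_op bul o)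
                    (sigma_at bul o) (s_at bul o) a b &
      forall a b : A,
        cur a b = affine_bracket (fibre_op cur o) mu lam t a b].

End Affgebras.

Arguments fibre_op {F A} op o a b.

(* Main.v *)
(* For bilinear mul and br and linear sigma, lam and mu, the affgebra axioms of
   a b + a sigma + sigma b + s and [a, b] + mu a + lam b + t can be separated
   into homogeneous parts by setting variables to 0.  Associativity then splits
   into associativity of mul and the homothetic-datum identities, and the affine
   Lie axioms split into the Lie axioms and the compatibility condition.  The
   fibre operation at o of B(a, b) + f a + g b is B(a - o, b - o) + o, so the
   deriffation condition on an affine map only says that its linear part is a
   derivation; this applies to [-, z] + mu and to [z, -] + lam, where z = 0
   isolates mu and lam.  Hence the standard structure is a Poisson affgebra if
   and only if all the algebraic conditions hold, and a |-> a - o identifies its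
   fibre at o with P.  In an arbitrary affgebra, a biaffine operation is its
   fibre at o plus linear terms and a constant, so over T_o A it is standard and
   the same equivalence gives the converse. *)
Require Import Defs.
From HB Require Import structures.
From mathcomp Require Import all_boot all_order all_algebra.

Set Implicit Arguments.
Unset Strict Implicit.
Unset Printing Implicit Defensive.

Import GRing.Theory.
Local Open Scope ring_scope.

(** * Deciding abelian group identities by comparing integer coefficients *)

Inductive zmod_expr :=
  | ZVar of nat | ZZero | ZOpp of zmod_expr | ZAdd of zmod_expr & zmod_expr.

Fixpoint zmod_eval (V : zmodType) (env : seq V) (e : zmod_expr) : V :=
  match e with
  | ZVar i => env`_i
  | ZZero => 0
  | ZOpp e1 => - zmod_eval env e1
  | ZAdd e1 e2 => zmod_eval env e1 + zmod_eval env e2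
  end.

Fixpoint zmod_coef (e : zmod_expr) (i : nat) : int :=
  match e with
  | ZVar j => if i == j then 1 else 0
  | ZZero => 0
  | ZOpp e1 => - zmod_coef e1 i
  | ZAdd e1 e2 => zmod_coef e1 i + zmod_coef e2 i
  end.

Lemma zmod_evalE (V : zmodType) (env : seq V) (e : zmod_expr) :
  zmod_eval env e = \sum_(i < size env) env`_i *~ zmod_coef e i.
Proof.
elim: e => [j||e IH|e1 IH1 e2 IH2] /=.
- have [lt_j|le_j] := ltnP j (size env).
    rewrite (bigD1 (Ordinal lt_j)) //= eqxx big1 ?addr0 // => i.
    by rewrite -val_eqE /= => /negPf ->.
  (* A variable index outside [env] reads the default [0] of [nth], and no summand has that
     index. *)
  rewrite nth_default // big1 // => i _.
  by rewrite ltn_eqF // (leq_trans (ltn_ord i)).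
- by rewrite big1.
- by rewrite IH -sumrN; apply: eq_bigr => i _; rewrite mulrNz.
- by rewrite IH1 IH2 -big_split; apply: eq_bigr => i _; rewrite mulrzDr.
Qed.

Lemma zmod_eval_eq (V : zmodType) (env : seq V) (e1 e2 : zmod_expr) :
  all (fun i => zmod_coef e1 i == zmod_coef e2 i) (iota 0 (size env)) ->
  zmod_eval env e1 = zmod_eval env e2.
Proof.
move=> /allP eq_coef; rewrite !zmod_evalE; apply: eq_bigr => i _.
by rewrite (eqP (eq_coef i _)) // mem_iota /= ltn_ord.
Qed.

(* The same scaling may occur with several forms of its module structure. *)
Ltac zmod_same x y :=
  lazymatch x with
  | @GRing.scale _ _ ?k ?u => lazymatch y with @GRing.scale _ _ k u => idtac end
  | _ => constr_eq x y
  end.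

Ltac zmod_index x env :=
  match env with
  | ?y :: _ => let _ := match goal with _ => zmod_same x y end in constr:(0%N)
  | _ :: ?env' => let n := zmod_index x env' in constr:(S n)
  end.

Ltac zmod_insert x env :=
  match env with
  | _ => let n := zmod_index x env in env
  | _ => lazymatch type of env with list ?T => constr:(@cons T x env) end
  end.

Ltac zmod_atoms e env :=
  lazymatch e with
  | @GRing.add _ ?a ?b => let env' := zmod_atoms a env in zmod_atoms b env'
  | @GRing.opp _ ?a => zmod_atoms a env
  | @GRing.zero _ => env
  | _ => zmod_insert e env
  end.

Ltac zmod_reify e env :=
  lazymatch e with
  | @GRing.add _ ?a ?b =>
      let ra := zmod_reify a env in let rb := zmod_reify b env in
      constr:(ZAdd ra rb)
  | @GRing.opp _ ?a => let ra := zmod_reify a env in constr:(ZOpp ra)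
  | @GRing.zero _ => constr:(ZZero)
  | _ => let n := zmod_index e env in constr:(ZVar n)
  end.

(* Proves the equations that hold in every abelian group, up to the
   identity of atoms given by [zmod_same]. *)
Ltac abel :=
  lazymatch goal with
  | |- @eq ?T ?a ?b =>
    let env := zmod_atoms a (@nil T) in
    let env := zmod_atoms b env in
    let ra := zmod_reify a env in
    let rb := zmod_reify b env in
    exact: (@zmod_eval_eq _ env ra rb isT)
  end.

(* [abel_from H] proves [x = y] from [H : u = v] when [x - y = u - v] in every
   abelian group. *)
Lemma eq_from_sub (V : zmodType) (u v x y : V) :
  u = v -> x - y = u - v -> x = y.
Proof. by move=> -> /eqP; rewrite subrr subr_eq0 => /eqP. Qed.

Ltac abel_from H := apply: (eq_from_sub H); abel.

(** * Linear and bilinear maps *)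

Lemma linearE (F : fieldType) (U V : lmodType F) (f : U -> V) : linear f ->
  (f 0 = 0) * (forall a, f (- a) = - f a) * (forall a b, f (a + b) = f a + f b).
Proof.
move=> lin_f.
have f0 : f 0 = 0.
  by have /eqP := lin_f 1 0 0; rewrite !scale1r addr0 -subr_eq0 opprD addrA
    subrr add0r oppr_eq0 => /eqP.
split; first split=> // a.
- by rewrite -[- a]addr0 -scaleN1r lin_f f0 addr0 scaleN1r.
- by move=> a b; rewrite -[a in LHS]scale1r lin_f scale1r.
Qed.

Lemma bilinearE (F : fieldType) (V : lmodType F) (op : V -> V -> V) :
  Defs.bilinear op ->
  (forall a, op a 0 = 0) * (forall a, op 0 a = 0) *
  (forall a b, op a (- b) = - op a b) * (forall a b, op (- a) b = - op a b) *
  (forall a b c, op a (b + c) = op a b + op a c) *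
  (forall a b c, op (a + b) c = op a c + op b c).
Proof.
move=> [linr linl].
have r a := linearE (linr a); have l a := linearE (linl a).
do !split=> *; first exact: (r _).1.1.
- exact: (l _).1.1.
- exact: (r _).1.2.
- exact: (l _).1.2.
- exact: (r _).2.
- exact: (l _).2.
Qed.

Lemma linearD (F : fieldType) (U V : lmodType F) (f g : U -> V) :
  linear f -> linear g -> linear (fun a => f a + g a).
Proof.
move=> lin_f lin_g k a b.
by rewrite lin_f lin_g scalerDr addrACA.
Qed.

Lemma linearN (F : fieldType) (U V : lmodType F) (f : U -> V) :
  linear f -> linear (fun a => - f a).
Proof. by move=> lin_f k a b; rewrite lin_f opprD scalerN. Qed.

Lemma eq_linear (F : fieldType) (U V : lmodType F) (f g : U -> V) :
  f =1 g -> linear f -> linear g.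
Proof. by move=> fg lin_f k a b; rewrite -!fg lin_f. Qed.

(** Linear parts of affine maps arise as bare functions, whereas the theorem asks for bundled linear
    maps. *)
Lemma linear_pack (F : fieldType) (U V : lmodType F) (f : U -> V) :
  linear f -> exists g : {linear U -> V}, g =1 f.
Proof.
move=> lin_f; pose fM := GRing.isLinear.Build F U V _ f lin_f.
pose g : {linear U -> V} := HB.pack f fM.
by exists g.
Qed.

(** * Tangent spaces and fibres of biaffine operations *)

Section Tangent.
Variables (F : fieldType) (A : affType F) (o : A).

Lemma heap_tangentE (a b c : tangent o) :
  heap (a : A) b c = a - b + c :> tangent o.
Proof.
rewrite /GRing.add /GRing.opp /= /tangent_add /tangent_opp.
by rewrite !heapA heapKl -heapA heapKr.
Qed.

Lemma act_tangentE (alpha : F) (a b : tangent o) :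
  act alpha (a : A) b = alpha *: b - alpha *: a + a :> tangent o.
Proof. by rewrite -heap_tangentE; apply: act_base. Qed.

(** This form uses the heap operation alone, so an affine map can be pushed through it. The last [o]
    is the zero of the tangent space. *)
Lemma fibre_opE (op : A -> A -> A) (a b : A) :
  fibre_op op o a b = heap (heap (op a b) (op a o) (op o o)) (op o b) o.
Proof.
rewrite /fibre_op !heap_tangentE; symmetry.
exact: (addr0 (_ : tangent o)).
Qed.

End Tangent.

(** Heap and action have linear expressions in every tangent space of [B], so [o'] may be any point;
    subtracting [f o] removes the constant term. *)
Lemma affine_map_linear (F : fieldType) (A B : affType F) (o : A) (o' : B)
    (f : A -> B) :
  affine_map f ->
  linear (fun a : tangent o => (f a : tangent o') - (f o : tangent o')).
Proof.
move=> [f_heap f_act] k a b.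
have -> : k *: a + b = heap (act k o (a : A)) o (b : A) :> A by [].
rewrite f_heap f_act heap_tangentE act_tangentE !scalerDr !scalerN.
abel.
Qed.

Arguments affine_map_linear {F A B} o o' {f}.

(** With [a] fixed, the fibre operation is the linear part of [op a] minus that of [op o]; the other
    variable is symmetric. *)
Lemma fibre_op_bilinear (F : fieldType) (A : affType F) (o : A)
    (op : A -> A -> A) :
  biaffine op -> Defs.bilinear (fibre_op op o).
Proof.
move=> [affr affl]; split=> a.
- apply: (eq_linear _ (linearD (affine_map_linear o o (affr a))
    (linearN (affine_map_linear o o (affr o))))) => b.
  by rewrite /fibre_op; abel.
- apply: (eq_linear _ (linearD (affine_map_linear o o (affl a))
    (linearN (affine_map_linear o o (affl o))))) => b.
  by rewrite /fibre_op; abel.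
Qed.

(** * Transport of structure along an affine map with a section *)

Section Transfer.
Variables (F : fieldType) (A B : affType F) (f : A -> B) (g : B -> A).
Hypotheses (f_aff : affine_map f) (gK : cancel g f).

Lemma affine_map_transfer (h : A -> A) (h' : B -> B) :
  (forall a, f (h a) = h' (f a)) -> affine_map h -> affine_map h'.
Proof.
move: f_aff => [f_heap f_act] fh [h_heap h_act]; split.
- move=> a b c; rewrite -[a]gK -[b]gK -[c]gK.
  by rewrite -f_heap -!fh h_heap f_heap.
- move=> k a b; rewrite -[a]gK -[b]gK.
  by rewrite -f_act -!fh h_act f_act.
Qed.

Lemma biaffine_transfer (op : A -> A -> A) (op' : B -> B -> B) :
  (forall a b, f (op a b) = op' (f a) (f b)) -> biaffine op -> biaffine op'.
Proof.
move=> fop [affr affl]; split=> a; rewrite -[a]gK.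
- exact: affine_map_transfer (fop (g a)) (affr _).
- exact: affine_map_transfer (fun b => fop b (g a)) (affl _).
Qed.

(** The identity at [o], [a], [b] is the image under [f] of the one at [g o], [g a], [g b], since
    both fibre operations are composed of heaps. *)
Lemma deriffation_transfer (bul : A -> A -> A) (bul' : B -> B -> B)
    (D : A -> A) (D' : B -> B) :
  (forall a b, f (bul a b) = bul' (f a) (f b)) ->
  (forall a, f (D a) = D' (f a)) ->
  deriffation bul D -> deriffation bul' D'.
Proof.
move=> fbul fD [D_aff D_der]; split; first exact: affine_map_transfer D_aff.
move=> o a b.
have f_defect u v : defect bul' D' (f u) (f v) = f (defect bul D u v).
  by rewrite /defect f_aff.1 !(fbul, fD).
have := congr1 f (D_der (g o) (g a) (g b)).
by rewrite !fibre_opE 2!f_aff.1 -!f_defect !gK.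
Qed.

Lemma poisson_affgebra_transfer (bul cur : A -> A -> A)
    (bul' cur' : B -> B -> B) :
  (forall a b, f (bul a b) = bul' (f a) (f b)) ->
  (forall a b, f (cur a b) = cur' (f a) (f b)) ->
  poisson_affgebra bul cur -> poisson_affgebra bul' cur'.
Proof.
move=> fbul fcur [[bul_aff bulA] [cur_aff cur_alt cur_jac] cur_der].
have f_heap := f_aff.1; split.
- split; first exact: biaffine_transfer bul_aff.
  by move=> a b c; rewrite -[a]gK -[b]gK -[c]gK -!fbul bulA.
- split; first exact: biaffine_transfer cur_aff.
  + by move=> a b; rewrite -[a]gK -[b]gK -!fcur -f_heap cur_alt.
  + move=> a b c; have := congr1 f (cur_jac (g a) (g b) (g c)).
    by rewrite /heap5 !(f_heap, fcur) !gK.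
- move=> z; rewrite -[z]gK; have [dl dr] := cur_der (g z); split.
  + exact: deriffation_transfer fbul (fun b => fcur b (g z)) dl.
  + exact: deriffation_transfer fbul (fcur (g z)) dr.
Qed.

End Transfer.

(** * The standard product and bracket on a vector space *)

Section Standard.
Variables (F : fieldType) (P : lmodType F).
Variables (mul br : P -> P -> P) (sigma : double_operator P) (s t : P).
Variables (lam mu : P -> P).
Hypotheses (mul_bilin : Defs.bilinear mul) (br_bilin : Defs.bilinear br).
Hypotheses (R_lin : linear (dop_r sigma)) (L_lin : linear (dop_l sigma)).
Hypotheses (lam_lin : linear lam) (mu_lin : linear mu).

Local Notation L := (dop_l sigma).
Local Notation R := (dop_r sigma).

Let bul : affine_of P -> affine_of P -> affine_of P :=
  homothetic_product mul sigma s.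
Let cur : affine_of P -> affine_of P -> affine_of P :=
  affine_bracket br mu lam t.

Let mulE := bilinearE mul_bilin.
Let brE := bilinearE br_bilin.
Let RE := linearE R_lin.
Let LE := linearE L_lin.
Let lamE := linearE lam_lin.
Let muE := linearE mu_lin.
Let expandE := (mulE, brE, RE, LE, lamE, muE).

Lemma affine_map_affine_of (d : P -> P) (c : P)
    (f : affine_of P -> affine_of P) :
  linear d -> (forall a, f a = d a + c :> P) -> affine_map f.
Proof.
move=> d_lin fE; split=> [a b e|k a b]; rewrite !fE.
- have -> : heap a b e = (a : P) - b + e by [].
  have -> : heap (d a + c : affine_of P) (d b + c) (d e + c) =
      (d a + c) - (d b + c) + (d e + c) :> P by [].
  (* The equation is retyped from the alias [affine_of P] to [P], where [abel] finds the group
     structure. *)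
  rewrite !(linearE d_lin); apply: (_ : @eq P _ _); abel.
- have -> : act k a b = (a : P) + k *: ((b : P) - a) by apply: vactE.
  have -> : act k (d a + c : affine_of P) (d b + c) =
      (d a + c) + k *: ((d b + c) - (d a + c)) by apply: vactE.
  rewrite [_ + k *: _]addrC d_lin (linearE d_lin).
  have -> : d b + c - (d a + c) = d b - d a by abel.
  rewrite (linearE d_lin) !scalerBr; apply: (_ : @eq P _ _); abel.
Qed.

(** The alternating sum cancels [f] and [g] and leaves [B (a - o) (b - o)]. The final [+ o] appears
    because sums are taken in [P], while the zero of the fibre is [o]. *)
Lemma fibre_op_affine_of (B : P -> P -> P) (f g : P -> P)
    (op : affine_of P -> affine_of P -> affine_of P) (o a b : affine_of P) :
  Defs.bilinear B -> (forall a b, op a b = B a b + f a + g b :> P) ->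
  fibre_op op o a b = B ((a : P) - o) ((b : P) - o) + o :> P.
Proof.
move=> B_bilin opE; rewrite fibre_opE !opE.
have -> (x y z : affine_of P) : heap x y z = (x : P) - y + z by [].
have -> (x y z : affine_of P) : heap x y z = (x : P) - y + z by [].
rewrite !(bilinearE B_bilin); abel.
Qed.

Lemma biaffine_homothetic_product : biaffine bul.
Proof.
split=> a.
- apply: (@affine_map_affine_of (fun b => mul a b + L b) (R a + s)).
    exact: linearD (mul_bilin.1 a) L_lin.
  by move=> b; rewrite /bul /homothetic_product; abel.
- apply: (@affine_map_affine_of (fun b => mul b a + R b) (L a + s)).
    exact: linearD (mul_bilin.2 a) R_lin.
  by move=> b; rewrite /bul /homothetic_product; abel.
Qed.

Lemma biaffine_affine_bracket : biaffine cur.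
Proof.
split=> a.
- apply: (@affine_map_affine_of (fun b => br a b + lam b) (mu a + t)).
    exact: linearD (br_bilin.1 a) lam_lin.
  by move=> b; rewrite /cur /affine_bracket; abel.
- apply: (@affine_map_affine_of (fun b => br b a + mu b) (lam a + t)).
    exact: linearD (br_bilin.2 a) mu_lin.
  by move=> b; rewrite /cur /affine_bracket; abel.
Qed.

Lemma assoc_affgebra_homothetic :
  assoc_affgebra bul <-> associative mul /\ homothetic_datum mul sigma s.
Proof.
split=> [[_ bulA]|[mulA [[_ _ [LM RM mulLR LR]] sLR RR LL]]].
- have E (a b c : P) : mul a (mul b c) + mul a (R b) + mul a (L c) + mul a s
      + R a + (L (mul b c) + L (R b) + L (L c) + L s) + s =
      mul (mul a b) c + mul (R a) c + mul (L b) c + mul s c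
      + (R (mul a b) + R (R a) + R (L b) + R s) + L c + s.
    have := bulA a b c; rewrite /bul /homothetic_product.
    by rewrite !expandE !addrA.
  (* Three, two, one and finally no variables are set to [0]; each identity found cancels the
     lower-order terms of the later ones. *)
  have sLR : L s = R s.
    by have := E 0 0 0; rewrite !expandE => H; abel_from H.
  have RR a : R (R a) = R a + mul a s.
    have := E a 0 0; rewrite !expandE sLR => H; symmetry; abel_from H.
  have LL a : L (L a) = L a + mul s a.
    have := E 0 0 a; rewrite !expandE sLR => H; abel_from H.
  have LR a : L (R a) = R (L a).
    have := E 0 a 0; rewrite !expandE sLR => H; abel_from H.
  have RM a b : R (mul a b) = mul a (R b).
    have := E a b 0; rewrite !expandE sLR RR LR => H; symmetry; abel_from H.
  have LM a b : L (mul a b) = mul (L a) b.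
    have := E 0 a b; rewrite !expandE sLR LL LR => H; abel_from H.
  have mulLR a b : mul a (L b) = mul (R a) b.
    have := E a 0 b; rewrite !expandE sLR LL RR => H; abel_from H.
  split=> // a b c.
  have := E a b c.
  rewrite sLR LL RR LR RM LM mulLR => H; abel_from H.
- split; first exact: biaffine_homothetic_product.
  move=> a b c; rewrite /bul /homothetic_product; apply: (_ : @eq P _ _).
  rewrite !expandE mulA sLR LL RR LR RM LM mulLR; abel.
Qed.

Lemma lie_affgebra_affine_bracket :
  lie_affgebra cur <-> lie_algebra br /\ bracket_compatible br mu lam.
Proof.
(* The two sides of the affine Jacobi identity are subtracted; [jacobiE] sorts the difference into
   terms in three, two and one variables. *)
pose jacobi_lhs (a b c : P) := cur a (cur b c) - cur a (cur a a) +
  cur b (cur c a) - cur b (cur b b) + cur c (cur a b) - cur c (cur c c).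
have jacobiE (br_alt : forall a, br a a = 0) a b c :
  jacobi_lhs a b c =
    br a (br b c) + br b (br c a) + br c (br a b)
    + (lam (br b c) + br b (lam a) + br c (mu a))
    + (lam (br c a) + br c (lam b) + br a (mu b))
    + (lam (br a b) + br a (lam c) + br b (mu c))
    - (br a (mu a) + br a (lam a)) - (br b (mu b) + br b (lam b))
    - (br c (mu c) + br c (lam c)).
  by rewrite /jacobi_lhs /cur /affine_bracket !br_alt !expandE; abel.
split=> [[_ cur_alt cur_jac]|[[_ br_alt br_jac] compat]].
- have br_alt a : br a a = 0.
    have H : cur a 0 - cur a a + cur 0 a = cur 0 0 := cur_alt a 0.
    rewrite /cur /affine_bracket !expandE in H; symmetry; abel_from H.
  have anti a b : br a b = - br b a.
    have := br_alt (a + b); rewrite !expandE !br_alt => H; abel_from H.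
  have J a b c : jacobi_lhs a b c = 0.
    rewrite /jacobi_lhs; apply/eqP; rewrite subr_eq0; apply/eqP.
    exact: cur_jac.
  (* Two zeros isolate the terms in [a] alone; one zero then gives the compatibility, and no zeros
     the Jacobi identity of [br]. *)
  have J1 a : br a (mu a) + br a (lam a) = 0.
    have := J a 0 0; rewrite (jacobiE br_alt) !expandE => H; symmetry; abel_from H.
  have compat : bracket_compatible br mu lam.
    move=> a b; have := J a b 0; rewrite (jacobiE br_alt) !J1.
    rewrite (anti (lam a)) !expandE => H; abel_from H.
  split=> //; split=> // a b c; have := J a b c.
  rewrite (jacobiE br_alt) !J1 !compat !(anti (lam _)) => H.
  abel_from H.
- have anti a b : br a b = - br b a.
    have := br_alt (a + b); rewrite !expandE !br_alt => H; abel_from H.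
  have J1 a : br a (mu a) + br a (lam a) = 0.
    (* On the diagonal the left side of the compatibility is [lam 0]. *)
    have := compat a a; rewrite br_alt (anti (lam a)) !expandE => H.
    abel_from H.
  split; first exact: biaffine_affine_bracket.
  + move=> a b; apply: (_ : cur a b - cur a a + cur b a = cur b b :> P).
    rewrite /cur /affine_bracket (anti b a) !br_alt; abel.
  + move=> a b c; have /eqP := jacobiE br_alt a b c.
    rewrite br_jac !J1 !compat !(anti (lam _)) => /eqP H.
    apply: (_ : @eq P _ _); have {}H : jacobi_lhs a b c = 0 by rewrite H; abel.
    apply/eqP; rewrite -subr_eq0; apply/eqP; exact: H.
Qed.

Lemma deriffation_homothetic (d : P -> P) (c : P)
    (D : affine_of P -> affine_of P) :
  associative mul -> homothetic_datum mul sigma s ->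
  linear d -> (forall a, D a = d a + c :> P) ->
  deriffation bul D <-> derivation mul d.
Proof.
move=> mulA hdat d_lin DE.
(* [B] measures the failure of the Leibniz rule for [d] and is the bilinear part of the defect of
   [D]; [f] and [g] collect the remaining terms, with all constants in [g]. *)
pose B a b := mul (d a) b - d (mul a b) + mul a (d b).
have B_bilin : Defs.bilinear B.
  by split=> a k u v; rewrite /B ?(mul_bilin.1, mul_bilin.2, d_lin, scalerDr,
    scalerN, linearE d_lin); abel.
pose f a := mul a c + R (d a) + R a - d (R a).
pose g b := mul c b + L b - d (L b) + L (d b) + (R c + s - (d s + c) + L c + s).
have defectE a b : defect bul D a b = B a b + f a + g b :> P.
  rewrite /defect; have -> (x y z : affine_of P) : heap x y z = (x : P) - y + z by [].
  rewrite DE /bul /homothetic_product !DE /B /f /g.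
  by rewrite !expandE !(linearE d_lin); abel.
split=> [[_ Dd]|[_ dM]].
- split=> // a b.
  have := Dd 0 a b.
  rewrite (fibre_op_affine_of _ _ _ B_bilin defectE) /B.
  rewrite !subr0 addr0.
  (* The zero of the tangent space at [0] is, by conversion, the zero of [P]. *)
  move=> H; have {}H : mul (d a) b - d (mul a b) + mul a (d b) = 0 :> P := H.
  symmetry; abel_from H.
- split; first exact: affine_map_affine_of d_lin DE.
  move=> o a b; rewrite (fibre_op_affine_of _ _ _ B_bilin defectE) /B dM.
  apply: (_ : _ = o :> P); abel.
Qed.

(** The algebraic conditions stand on the right-hand side so that the converse can read them off
    from the affgebra axioms of a fibre. *)
Lemma poisson_affgebra_standard :
  poisson_affgebra bul cur <->
  [/\ poisson_algebra mul br, homothetic_datum mul sigma s,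
      bracket_compatible br mu lam, derivation mul lam & derivation mul mu].
Proof.
have curl z a : cur a z = br a z + mu a + (lam z + t) :> P.
  by rewrite /cur /affine_bracket; abel.
have curr z b : cur z b = br z b + lam b + (mu z + t) :> P.
  by rewrite /cur /affine_bracket; abel.
have linl z := linearD (br_bilin.2 z) mu_lin.
have linr z := linearD (br_bilin.1 z) lam_lin.
split.
- move=> [/assoc_affgebra_homothetic [mulA hd]].
  move=> /lie_affgebra_affine_bracket [lie compat] der.
  have derl z : derivation mul (fun a => br a z + mu a).
    by apply/(deriffation_homothetic mulA hd (linl z) (curl z)); case: (der z).
  have derr z : derivation mul (fun b => br z b + lam b).
    by apply/(deriffation_homothetic mulA hd (linr z) (curr z)); case: (der z).
  have mu_der : derivation mul mu.
    by split=> // a b; have := (derl 0).2 a b; rewrite !brE !add0r.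
  have lam_der : derivation mul lam.
    by split=> // a b; have := (derr 0).2 a b; rewrite !brE !add0r.
  split=> //; split=> // a b z.
  (* Removing the rule for [mu] from the rule for [[-, z] + mu] leaves the Leibniz rule of the
     bracket. *)
  have := (derl z).2 a b; rewrite mu_der.2 !expandE => H; abel_from H.
- move=> [[[_ mulA] lie leibniz] hd compat lam_der mu_der].
  have anti a b : br a b = - br b a.
    have [_ br_alt _] := lie.
    have := br_alt (a + b); rewrite !expandE !br_alt => H; abel_from H.
  split; first exact/assoc_affgebra_homothetic.
    exact/lie_affgebra_affine_bracket.
  move=> z; split.
  + apply/(deriffation_homothetic mulA hd (linl z) (curl z)); split=> // a b.
    by rewrite leibniz mu_der.2 !expandE; abel.
  + apply/(deriffation_homothetic mulA hd (linr z) (curr z)); split=> // a b.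
    by rewrite anti leibniz lam_der.2 !(anti z) !expandE; abel.
Qed.

Lemma fibre_homothetic_product (o a b : affine_of P) :
  fibre_op bul o a b = mul ((a : P) - o) ((b : P) - o) + o :> P.
Proof.
apply: (@fibre_op_affine_of _ R (fun b => L b + s) _ _ _ _ mul_bilin) => u v.
by rewrite /bul /homothetic_product; abel.
Qed.

Lemma fibre_affine_bracket (o a b : affine_of P) :
  fibre_op cur o a b = br ((a : P) - o) ((b : P) - o) + o :> P.
Proof.
apply: (@fibre_op_affine_of _ mu (fun b => lam b + t) _ _ _ _ br_bilin) => u v.
by rewrite /cur /affine_bracket; abel.
Qed.

Lemma poisson_isomorphic_fibre (o : affine_of P) :
  poisson_isomorphic (fibre_op bul o) (fibre_op cur o) mul br.
Proof.
have f_lin : linear (fun a : tangent o => (a : P) - o).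
  move=> k a b.
  (* Scaling in the tangent space is [vact] based at [o], and addition is the heap operation with
     middle argument [o]. *)
  have -> : k *: a + b = ((1 - k) *: (o : P) + k *: (a : P)) - o + b :> P by [].
  by rewrite scalerBl scale1r scalerBr; abel.
have [f fE] := linear_pack f_lin; exists f; split=> [|a b|a b].
- by exists (fun a : P => a + (o : P)) => a; rewrite fE ?subrK ?addrK.
- by rewrite !fE fibre_homothetic_product addrK.
- by rewrite !fE fibre_affine_bracket addrK.
Qed.

End Standard.

(** * An arbitrary Poisson affgebra over its fibre *)

Lemma equals_standard_fibre (F : fieldType) (A : affType F)
    (bul cur : A -> A -> A) (o : A) :
  biaffine cur ->
  exists (mu lam : {linear tangent o -> tangent o}) (t : tangent o),
    equals_standard bul cur mu lam t.
Proof.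
move=> [affr affl].
(* [lam] and [mu] are the linear parts of [cur o] and [cur^~ o]; with the constant [cur o o] they
   restore exactly what the fibre bracket subtracts from [cur]. *)
have [lam lamE] := linear_pack (affine_map_linear o o (affr o)).
have [mu muE] := linear_pack (affine_map_linear o o (affl o)).
exists mu, lam, (cur o o : tangent o); split=> [a b c|k a b|a b|a b].
- exact: heap_tangentE.
- rewrite (act_tangentE (o := o)).
  apply: etrans (esym (vactE (P := tangent o) k a b)).
  by rewrite scalerBr addrC.
- rewrite /homothetic_product /fibre_op /= /s_at.
  by apply: (_ : _ = _ :> tangent o); abel.
- rewrite /affine_bracket lamE muE /fibre_op.
  by apply: (_ : _ = _ :> tangent o); abel.
Qed.

(** The identity is an affine map from [A] to the affine space of its tangent space, so the axioms
    transfer to the standard form. As [mu], [lam] and [t] are arbitrary here, the conditions on them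
    are necessary ones. *)
Lemma poisson_affgebra_fibre (F : fieldType) (A : affType F)
    (bul cur : A -> A -> A) (o : A)
    (mu lam : {linear tangent o -> tangent o}) (t : tangent o) :
  poisson_affgebra bul cur -> equals_standard bul cur mu lam t ->
  [/\ poisson_algebra (fibre_op bul o) (fibre_op cur o),
      homothetic_datum (fibre_op bul o) (sigma_at bul o) (s_at bul o),
      bracket_compatible (fibre_op cur o) mu lam,
      derivation (fibre_op bul o) lam & derivation (fibre_op bul o) mu].
Proof.
move=> pois [heapE actE bulE curE].
have [[bul_aff _] [cur_aff _ _] _] := pois.
have R_lin := affine_map_linear o o (bul_aff.2 o).
have L_lin := affine_map_linear o o (bul_aff.1 o).
apply/(@poisson_affgebra_standard F (tangent o) _ _ (sigma_at bul o) _ t _ _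
  (fibre_op_bilinear o bul_aff) (fibre_op_bilinear o cur_aff) R_lin L_lin
  (linearP lam) (linearP mu)).
by apply: (@poisson_affgebra_transfer F A (affine_of (tangent o)) id id)
  pois => //; split.
Qed.

Theorem theorem4p5 (F : fieldType) :
  (forall (P : lmodType F) (mul br : P -> P -> P)
      (sigma : double_operator P) (s t : P) (lam mu : {linear P -> P}),
    poisson_algebra mul br ->
    homothetic_datum mul sigma s ->
    bracket_compatible br mu lam ->
    let bul : affine_of P -> affine_of P -> affine_of P :=
      homothetic_product mul sigma s in
    let cur : affine_of P -> affine_of P -> affine_of P :=
      affine_bracket br mu lam t in
    (poisson_affgebra bul cur <-> derivation mul lam /\ derivation mul mu) /\
    (poisson_affgebra bul cur ->
     forall o : affine_of P,
       poisson_algebra (fibre_op bul o) (fibre_op cur o) /\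
       poisson_isomorphic (fibre_op bul o) (fibre_op cur o) mul br)) /\
  (forall (A : affType F) (bul cur : A -> A -> A) (o : A),
    poisson_affgebra bul cur ->
    [/\ poisson_algebra (fibre_op bul o) (fibre_op cur o),
        homothetic_datum (fibre_op bul o) (sigma_at bul o) (s_at bul o),
        exists (mu lam : {linear tangent o -> tangent o}) (t : tangent o),
          equals_standard bul cur mu lam t &
        forall (mu lam : {linear tangent o -> tangent o}) (t : tangent o),
          equals_standard bul cur mu lam t ->
          [/\ derivation (fibre_op bul o) mu,
              derivation (fibre_op bul o) lam &
              bracket_compatible (fibre_op cur o) mu lam]]).
Proof.
split=> [P mul br sigma s t lam mu [[mul_bilin mulA] lie leibniz] hd compat|].
  move=> bul cur; have [[br_bilin _ _] [[R_lin L_lin _] _ _ _]] := (lie, hd).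
  have standard : poisson_affgebra bul cur <-> _ :=
    poisson_affgebra_standard s t mul_bilin br_bilin R_lin L_lin
      (linearP lam) (linearP mu).
  split; first by split=> [/standard [] //|[lam_der mu_der]]; apply/standard.
  move=> pois o; split; last first.
    exact: poisson_isomorphic_fibre.
  (* The Poisson axioms of the fibre come from the converse direction, applied to [affine_of P] at
     [o]. *)
  have [_ [cur_aff _ _] _] := pois.
  have [mu' [lam' [t' eq_std]]] := equals_standard_fibre bul o cur_aff.
  by have [] := poisson_affgebra_fibre pois eq_std.
move=> A bul cur o pois; have [_ [cur_aff _ _] _] := pois.
have ex_std := equals_standard_fibre bul o cur_aff.
have [mu [lam [t eq_std]]] := ex_std.
have [pois_fibre hd _ _ _] := poisson_affgebra_fibre pois eq_std.
by split=> // mu' lam' t' /(poisson_affgebra_fibre pois) [].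
Qed.
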